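(* Let $X$ be a real Banach space, $X \neq \{0\}$. If $X$ has the strong diameter 2 property (SD2P), then the bidual $X^{**}$ contains an isometric copy of $L_1[0,1]$ (i.e. there is a linear isometric embedding $L_1[0,1] \to X^{**}$).
   Context: $B_X$ and $S_X$ denote the closed unit ball and the unit sphere of $X$; $X^*$ is the topological dual. A slice of $B_X$ is a set of the form $S(x^*,\varepsilon)=\{x\in B_X : x^*(x)>1-\varepsilon\}$ with $x^*\in S_{X^*}$ and $\varepsilon>0$. $X$ has the strong diameter 2 property (SD2P) if every finite convex combination of slices of $B_X$, i.e. every set $\sum_{i=1}^n\lambda_i S_i=\{\sum_{i=1}^n\lambda_i x_i : x_i\in S_i\}$ with $S_i$ slices of $B_X$, $\lambda_i\ge 0$, $\sum_{i=1}^n\lambda_i=1$, has diameter 2. *)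

(* Defs.v *)
From HB Require Import structures.
From mathcomp Require Import all_boot all_order all_algebra.
From mathcomp Require Import all_classical all_reals all_analysis.
From mathcomp Require Import measurable_realfun.

Set Implicit Arguments.
Unset Strict Implicit.
Unset Printing Implicit Defensive.

Import Order.TTheory GRing.Theory Num.Theory.
Import numFieldNormedType.Exports.

Local Open Scope classical_set_scope.
Local Open Scope ring_scope.

Definition unit_ball (R : realType) (V : normedModType R) : set V :=
  [set x | `|x| <= 1].
Arguments unit_ball {R} V.

Section Dual.
Context (R : realType) (V : normedModType R).

Definition continuous_linear : {pred V -> R} :=
  [pred f : V -> R | `[< linear f /\ continuous f >]].

Lemma continuous_linearP (f : V -> R) :
  reflect (linear f /\ continuous f) (f \in continuous_linear).
Proof. exact: asboolP. Qed.

Lemma continuous_linear_submod_closed : submod_closed continuous_linear.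
Proof.
split.
  apply/continuous_linearP; split; last exact: cst_continuous.
  by move=> a x y /=; rewrite scaler0 addr0.
move=> a f g /continuous_linearP[lf cf] /continuous_linearP[lg cg].
apply/continuous_linearP; split.
  move=> b x y; rewrite !fctE lf lg !scalerDr !scalerA (mulrC a).
  by rewrite -!addrA; congr (_ + _); rewrite addrCA.
by move=> x; apply: cvgD; [apply: cvgZl_tmp; exact: cf|exact: cg].
Qed.

HB.instance Definition _ := GRing.isSubmodClosed.Build _ _ continuous_linear
  continuous_linear_submod_closed.

Record dual := Dual {
  dual_fun :> V -> R;
  dual_funP : dual_fun \in continuous_linear }.

HB.instance Definition _ := [isSub for dual_fun].
HB.instance Definition _ := [Choice of dual by <:].
HB.instance Definition _ := [SubChoice_isSubLmodule of dual by <:].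

Lemma dual_linear (f : dual) : linear f.
Proof. by have /continuous_linearP[] := dual_funP f. Qed.

HB.instance Definition _ (f : dual) :=
  GRing.isLinear.Build R V R _ f (dual_linear f).

Lemma dual_continuous (f : dual) : continuous f.
Proof. by have /continuous_linearP[] := dual_funP f. Qed.

Lemma dualP (f g : dual) : f =1 g -> f = g.
Proof. by move=> fg; apply/val_inj/funext. Qed.

Lemma dualDE (f g : dual) x : (f + g) x = f x + g x.
Proof. by []. Qed.

Lemma dualZE a (f : dual) x : (a *: f) x = a * f x.
Proof. by []. Qed.

Definition dual_norm (f : dual) : R := sup [set `|f x| | x in unit_ball V].

Lemma dual_norm_has_sup (f : dual) :
  has_sup [set `|f x| | x in unit_ball V].
Proof.
split; first by exists `|f 0|, 0 => //; rewrite /unit_ball/= normr0.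
have /linear_bounded_continuous := @dual_continuous f.
move=> /bounded_funP/(_ 1)[M fM]; exists M => _ [x xB <-].
exact: fM.
Qed.

Lemma dual_norm_ub (f : dual) x : `|x| <= 1 -> `|f x| <= dual_norm f.
Proof.
by move=> x1; apply: ub_le_sup; [case: (dual_norm_has_sup f)|exists x].
Qed.

Lemma dual_norm_le (f : dual) c :
  (forall x, `|x| <= 1 -> `|f x| <= c) -> dual_norm f <= c.
Proof.
move=> fc; apply: ge_sup; first by case: (dual_norm_has_sup f).
by move=> _ [x xB <-]; exact: fc.
Qed.

Lemma dual_normD (f g : dual) : dual_norm (f + g) <= dual_norm f + dual_norm g.
Proof.
apply: dual_norm_le => x x1; rewrite dualDE (le_trans (ler_normD _ _))//.
by rewrite lerD// dual_norm_ub.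
Qed.

Lemma dual_normZ a (f : dual) : dual_norm (a *: f) = `|a| * dual_norm f.
Proof.
have le b (g : dual) : dual_norm (b *: g) <= `|b| * dual_norm g.
  apply: dual_norm_le => x x1; rewrite dualZE normrM.
  by rewrite ler_wpM2l// dual_norm_ub.
apply/eqP; rewrite eq_le le/=.
have [->|a0] := eqVneq a 0.
  rewrite normr0 mul0r.
  by rewrite (le_trans _ (@dual_norm_ub _ 0 _))// normr0.
rewrite -ler_pdivlMl ?normr_gt0// -normfV.
by rewrite -{1}[f](scalerK a0) le.
Qed.

Lemma dual_norm0_eq0 (f : dual) : dual_norm f = 0 -> f = 0.
Proof.
move=> f0; apply: dualP => x /=.
have [->|x0] := eqVneq x 0; first by rewrite linear0.
have : `|f (`|x|^-1 *: x)| <= 0.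
  by rewrite -f0 dual_norm_ub// normrZ normfV normr_id mulVf// normr_eq0.
rewrite normr_le0 linearZ/= scaler_eq0 invr_eq0 normr_eq0 (negbTE x0)/=.
by move/eqP.
Qed.

HB.instance Definition _ :=
  Lmodule_isNormed.Build R dual dual_normD dual_normZ dual_norm0_eq0.

End Dual.
Arguments dual {R} V.

Section StrongDiameterTwo.
Context (R : realType) (X : normedModType R).

Definition slice (f : dual X) (e : R) : set X :=
  unit_ball X `&` [set x | f x > 1 - e].

Definition is_slice (S : set X) : Prop :=
  exists (f : dual X) (e : R), [/\ `|f| = 1, 0 < e & S = slice f e].

Definition convex_combination (n : nat) (l : 'I_n -> R) (S : 'I_n -> set X) :
    set X :=
  [set \sum_i l i *: x i | x in [set x : 'I_n -> X | forall i, S i (x i)]].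

Definition diameter (A : set X) : \bar R :=
  ereal_sup [set `|x - y|%:E | x in A & y in A].

Definition SD2P : Prop :=
  forall (n : nat) (l : 'I_n -> R) (S : 'I_n -> set X),
    (forall i, 0 <= l i) -> \sum_i l i = 1 -> (forall i, is_slice (S i)) ->
    diameter (convex_combination l S) = 2%:E.

End StrongDiameterTwo.
Arguments SD2P {R} X.

(* In the library, LspaceType1 mu (integrable functions modulo a.e. equality) is
   a bare type: it has no vector space structure and no norm. *)
Section L1.
Context d (T : measurableType d) (R : realType).
Variable mu : {measure set T -> \bar R}.

Local Notation Lf := (LfunType mu (@lexx _ _ 1%E)).

Definition L1 : Type := LspaceType1 mu.

Implicit Types (x y z : L1) (f g : Lf).

HB.instance Definition _ := gen_eqMixin L1.
HB.instance Definition _ := gen_choiceMixin L1.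

Definition L1_fun x : T -> R := LebesgueSpace.sort x.

Lemma L1_fun_Lfun x : L1_fun x \in Lfun mu 1.
Proof.
apply/andP; split; rewrite inE/=.
  exact: (@measurable_funPT _ _ _ _ (repr (LebesgueSpace.sort x))).
by case: x => f [[]].
Qed.

Definition L1_repr x : Lf := Lfun_Sub (lexx 1%E) (L1_fun_Lfun x).

Definition mfun_of f : {mfun T >-> measurableTypeR R} :=
  mfun_Sub (mem_set (@measurable_funPT _ _ _ _ f) :
    (f : T -> measurableTypeR R) \in mfun).

Definition mfun_class f : {mfun_ mu, T >-> measurableTypeR R} :=
  \pi_({mfun_ mu, T >-> measurableTypeR R})%qT (mfun_of f).

Lemma mfun_classE f : (mfun_class f : T -> R) = f %[ae mu].
Proof. by have /eqmodP/asboolP := reprK (mfun_class f). Qed.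

Lemma ae_eq_Lnorm1 (f g : T -> R) :
  measurable_fun setT f -> measurable_fun setT g -> f = g %[ae mu] ->
  'N[mu]_1%E[EFin \o f]%E = 'N[mu]_1%E[EFin \o g]%E.
Proof.
move=> mf mg fg; rewrite !Lnorm1; apply: ge0_ae_eq_integral => //.
- by apply: measurableT_comp => //; exact/measurable_EFinP.
- by apply: measurableT_comp => //; exact/measurable_EFinP.
- by apply: filterS fg => x fgx _ /=; rewrite fgx.
Qed.

Lemma mfun_class_finite f : finite_norm mu 1 (mfun_class f).
Proof.
rewrite /finite_norm (ae_eq_Lnorm1 _ _ (mfun_classE f)).
- exact: Lfunction_finite.
- exact: (@measurable_funPT _ _ T (measurableTypeR R)).
- exact: measurable_funPT.
Qed.

Definition L1_pi f : L1 :=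
  @LebesgueSpace.Pack _ _ _ mu _ (lexx 1%E) _
    (LebesgueSpace.Class
       (isFinLebesgue.Axioms_ _ _ _ _ (lexx 1%E) _ (mfun_class_finite f))).

Lemma L1_reprE x : L1_repr x = L1_fun x :> (T -> R).
Proof. by []. Qed.

Lemma L1_piK f : L1_repr (L1_pi f) = f %[ae mu].
Proof. exact: mfun_classE. Qed.

Lemma L1_eq x y : L1_fun x = L1_fun y %[ae mu] -> x = y.
Proof.
case: x => x [[hx]]; case: y => y [[hy]] /= xy.
have {}xy : x = y.
  by rewrite -[x]reprK -[y]reprK; apply/eqmodP/asboolP.
case: _ / xy in hy *; congr LebesgueSpace.Pack.
by congr LebesgueSpace.Class; congr isFinLebesgue.Axioms_; exact: Prop_irrelevance.
Qed.

Lemma L1_pi_eq f g : f = g %[ae mu] -> L1_pi f = L1_pi g.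
Proof.
move=> fg; apply: L1_eq; apply: ae_eq_trans (L1_piK f) _.
by apply: ae_eq_trans fg _; apply: ae_eq_sym; exact: L1_piK.
Qed.

Lemma L1_reprK x : L1_pi (L1_repr x) = x.
Proof. by apply: L1_eq; exact: L1_piK. Qed.

Definition L1_zero : L1 := L1_pi 0.
Definition L1_opp x : L1 := L1_pi (- L1_repr x).
Definition L1_add x y : L1 := L1_pi (L1_repr x + L1_repr y).
Definition L1_scale (a : R) x : L1 := L1_pi (a *: L1_repr x).
Definition L1_norm x : R := fine 'N[mu]_1%E[EFin \o L1_repr x]%E.

Lemma LfDE f g t : (f + g) t = f t + g t. Proof. by []. Qed.
Lemma LfNE f t : (- f) t = - f t. Proof. by []. Qed.
Lemma LfZE a f t : (a *: f) t = a * f t. Proof. by []. Qed.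

Lemma L1_piD f g : L1_add (L1_pi f) (L1_pi g) = L1_pi (f + g).
Proof.
apply: L1_pi_eq; apply: filterS2 (L1_piK f) (L1_piK g) => t + + _.
by move=> /(_ I) ft /(_ I) gt; rewrite !LfDE ft gt.
Qed.

Lemma L1_piN f : L1_opp (L1_pi f) = L1_pi (- f).
Proof.
apply: L1_pi_eq; apply: filterS (L1_piK f) => t + _.
by move=> /(_ I) ft; rewrite !LfNE ft.
Qed.

Lemma L1_piZ a f : L1_scale a (L1_pi f) = L1_pi (a *: f).
Proof.
apply: L1_pi_eq; apply: filterS (L1_piK f) => t + _.
by move=> /(_ I) ft; rewrite !LfZE ft.
Qed.

Lemma L1_normE f : L1_norm (L1_pi f) = fine 'N[mu]_1%E[EFin \o f]%E.
Proof.
by rewrite /L1_norm (ae_eq_Lnorm1 _ _ (L1_piK f))//; exact: measurable_funPT.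
Qed.

Lemma L1_normEint x : (L1_norm x)%:E = (\int[mu]_t `|(L1_fun x t)%:E|)%E.
Proof. by rewrite finite_norm_fine Lnorm1. Qed.

Lemma L1_addA : associative L1_add.
Proof.
move=> x y z; rewrite -(L1_reprK x) -(L1_reprK y) -(L1_reprK z).
by rewrite !L1_piD addrA.
Qed.

Lemma L1_addC : commutative L1_add.
Proof. by move=> x y; rewrite /L1_add addrC. Qed.

Lemma L1_add0 : left_id L1_zero L1_add.
Proof. by move=> x; rewrite -(L1_reprK x) L1_piD add0r. Qed.

Lemma L1_addN : left_inverse L1_zero L1_opp L1_add.
Proof. by move=> x; rewrite -(L1_reprK x) L1_piN L1_piD addNr. Qed.

HB.instance Definition _ :=
  GRing.isZmodule.Build L1 L1_addA L1_addC L1_add0 L1_addN.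

Lemma L1_scaleA a b x : L1_scale a (L1_scale b x) = L1_scale (a * b) x.
Proof. by rewrite -(L1_reprK x) !L1_piZ scalerA. Qed.

Lemma L1_scale1 : left_id 1 L1_scale.
Proof. by move=> x; rewrite -(L1_reprK x) L1_piZ scale1r. Qed.

Lemma L1_scaleDr : right_distributive L1_scale +%R.
Proof.
move=> a x y; rewrite -[_ + _]/(L1_add _ _) -[RHS]/(L1_add _ _).
by rewrite -(L1_reprK x) -(L1_reprK y) !(L1_piZ, L1_piD) scalerDr.
Qed.

Lemma L1_scaleDl x : {morph L1_scale^~ x : a b / a + b}.
Proof.
move=> a b; rewrite -[RHS]/(L1_add _ _).
by rewrite -(L1_reprK x) !(L1_piZ, L1_piD) scalerDl.
Qed.

HB.instance Definition _ := GRing.Zmodule_isLmodule.Build R L1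
  L1_scaleA L1_scale1 L1_scaleDr L1_scaleDl.

Lemma L1_normD x y : L1_norm (x + y) <= L1_norm x + L1_norm y.
Proof. by rewrite -[x + y]/(L1_pi _) L1_normE; exact: ler_LnormD. Qed.

Lemma L1_normZ a x : L1_norm (a *: x) = `|a| * L1_norm x.
Proof.
rewrite -[a *: x]/(L1_pi _) L1_normE.
by apply: EFin_inj; rewrite EFinM !finite_norm_fine -LnormZ.
Qed.

Lemma L1_norm0_eq0 x : L1_norm x = 0 -> x = 0.
Proof.
by move=> /fine_Lnormr_eq0 x0; rewrite -(L1_reprK x); exact: L1_pi_eq.
Qed.

HB.instance Definition _ :=
  Lmodule_isNormed.Build R L1 L1_normD L1_normZ L1_norm0_eq0.

End L1.

(* A measure on R null outside [0, 1]: in L1 (lebesgue01 R) the values of a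
   function outside [0, 1] are irrelevant, so this space is L_1[0, 1]. *)
Definition lebesgue01 (R : realType) :
    {measure set (measurableTypeR R) -> \bar R} :=
  mrestr lebesgue_measure (measurable_itv `[0%R, 1%R]).

(* Main.v *)
(* The SD2P yields, for any tolerances d_n > 0, functionals y_n in the unit ball
   of X^* and, for every finite string of signs s, a point x_s of B_X at which
   s_n y_n is at least 1 - d_n for all n: given a slice for each string of
   length n, the average of these slices contains two points almost 2 apart, so
   the functional y_n norming their difference almost attains 1 and -1 on every
   slice, and intersecting with {+- y_n close to 1} gives the next slices.
   Let the measurable sets D_n be such that every measurable subset of [0, 1] is
   approximated in measure by some D_n with d_n arbitrarily small, and let s(t)
   be the signs recording which D_n contain t. Then
     (iota f)(y) = lim_N int f(t) y(x_{s(t)_0 .. s(t)_{N-1}}) dt,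
   a limit along an ultrafilter, has norm at most |f|; and if D_n almost is
   {f < 0} then (iota f)(y_n) is almost int |f|. *)

Require Import Defs.
From mathcomp Require Import all_boot all_order all_algebra.
From mathcomp Require Import all_classical all_reals all_analysis.
From HB Require Import structures.
From mathcomp Require Import measurable_realfun lra.

Import Order.TTheory GRing.Theory Num.Theory.
Import numFieldNormedType.Exports.

Local Open Scope classical_set_scope.
Local Open Scope ring_scope.

(** * The Hahn-Banach theorem through minimal sublinear functionals *)

Section HahnBanach.
Context {R : realType} {V : lmodType R}.
Implicit Types (p q : V -> R) (u v w : V).

Definition sublinear p :=
  (forall u v, p (u + v) <= p u + p v) /\
  (forall (a : R) v, 0 <= a -> p (a *: v) <= a * p v).

Lemma sublinear_oppr_le {p} v : sublinear p -> - p (- v) <= p v.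
Proof.
move=> [pD pZ]; have p00 : p 0 <= p 0 + p 0 by rewrite -{1}(addr0 0) pD.
have := pD v (- v); rewrite subrr; lra.
Qed.

Lemma sublinearZ {p} {a : R} v : sublinear p -> 0 <= a -> p (a *: v) = a * p v.
Proof.
move=> /[dup] p_sub [_ pZ]; rewrite le_eqVlt => /predU1P[<-|a0].
  rewrite scale0r mul0r; apply/eqP; rewrite eq_le -{1}(scale0r 0).
  rewrite -[leRHS](mul0r (p 0)) pZ//=.
  by have := sublinear_oppr_le 0 p_sub; rewrite oppr0; lra.
apply/eqP; rewrite eq_le (pZ _ _ (ltW a0))/= -ler_pdivlMl//.
by rewrite -{1}[v](scalerK (lt0r_neq0 a0)) pZ// invr_ge0 ltW.
Qed.

(** Sublinearity always gives [- q (- v) <= q v], so the hypothesis makes [q] odd. Subadditivity at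
    [- u] and [- v] is then the reverse inequality, and homogeneity extends to negative scalars. *)
Lemma sublinear_odd_linear q :
  sublinear q -> (forall v, q (- v) <= - q v) -> linear q.
Proof.
move=> /[dup] q_sub [qD qZ] qN.
have qNE v : q (- v) = - q v.
  by apply/eqP; rewrite eq_le qN lerNl sublinear_oppr_le.
have qDE u v : q (u + v) = q u + q v.
  apply/eqP; rewrite eq_le qD /=.
  by have := qD (- u) (- v); rewrite -opprD !qNE; lra.
have qZE a v : 0 <= a -> q (a *: v) = a * q v.
  move=> a0; apply/eqP; rewrite eq_le qZ//=.
  by have := qZ a (- v) a0; rewrite scalerN !qNE; lra.
move=> a u v; rewrite qDE; congr (_ + _).
have [a0|a0] := leP 0 a; first exact: qZE.
by rewrite -[a]opprK scaleNr qNE qZE ?oppr_ge0 ?ltW// scaleNr.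
Qed.

(* Pushing p down in the direction of v: the infimum over t >= 0 of
   p (w + t v) - t p v is the largest sublinear functional below p whose value
   at - v is at most - p v. *)
Lemma sublinear_descent {p} v : sublinear p ->
  exists q, [/\ sublinear q, forall w, q w <= p w & q (- v) <= - p v].
Proof.
move=> /[dup] p_sub [pD pZ].
pose S w := [set p (w + t *: v) - t * p v | t in [set t : R | 0 <= t]].
have Sw w : S w (p w).
  by exists 0; rewrite //= scale0r addr0 mul0r subr0.
have S_lb w : lbound (S w) (- p (- w)).
  move=> _ [t /= t0 <-]; have := pD (w + t *: v) (- w).
  by rewrite addrAC subrr add0r (sublinearZ v p_sub t0); lra.
have infS_le w t : 0 <= t -> inf (S w) <= p (w + t *: v) - t * p v.
  by move=> t0; apply: ge_inf; [exists (- p (- w))|exists t].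
have le_infS w c : (forall t, 0 <= t -> c <= p (w + t *: v) - t * p v) ->
    c <= inf (S w).
  move=> ct; apply: lb_le_inf; first by exists (p w).
  by move=> _ [t t0 <-]; exact: ct.
exists (fun w => inf (S w)); split.
- split=> [u w|a w a0].
    rewrite -lerBlDr; apply: (le_infS) => s s0; rewrite lerBlDr -lerBlDl.
    apply: (le_infS) => t t0; have := infS_le (u + w) (s + t) (addr_ge0 s0 t0).
    have := pD (u + s *: v) (w + t *: v).
    by rewrite scalerDl addrACA mulrDl; lra.
  move: a0; rewrite le_eqVlt => /predU1P[<-|a0].
    rewrite scale0r mul0r.
    have := infS_le 0 0 (lexx 0); rewrite scale0r addr0 mul0r subr0.
    by rewrite -{2}(scale0r 0) (sublinearZ _ p_sub) ?mul0r.
  rewrite -ler_pdivrMl//; apply: (le_infS) => t t0; rewrite ler_pdivrMl//.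
  apply: le_trans (infS_le _ (a * t) (mulr_ge0 (ltW a0) t0)) _.
  by rewrite -scalerA -scalerDr (sublinearZ _ p_sub) ?(ltW a0)// -mulrA -mulrBr.
- by move=> w; have := infS_le w 0 (lexx 0); rewrite scale0r addr0 mul0r subr0.
- have := infS_le (- v) 1 ler01; rewrite scale1r addNr mul1r.
  have := sublinearZ 0 p_sub (lexx 0); rewrite scale0r mul0r => ->.
  by rewrite sub0r.
Qed.

(** Zorn's lemma for the reversed pointwise order on the sublinear functionals below [p]: a nonempty
    chain is bounded by its pointwise infimum, which is again sublinear. *)
Lemma minimal_sublinear {p} : sublinear p -> exists q,
  [/\ sublinear q, forall v, q v <= p v &
      forall q', sublinear q' -> (forall v, q' v <= q v) -> q' = q].
Proof.
move=> p_sub; pose T := {q | sublinear q /\ forall v, q v <= p v}.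
pose ge (q1 q2 : T) := `[< forall v, sval q2 v <= sval q1 v >].
pose mkT q (qP : sublinear q /\ forall v, q v <= p v) : T := exist _ q qP.
have [q qmin] : exists q : T, forall q' : T, ge q q' -> q' = q.
  apply: Zorn => [q|q1 q2 q3|q1 q2|C C_total].
  - exact/asboolP.
  - move=> /asboolP q12 /asboolP q23; apply/asboolP => v.
    exact: le_trans (q12 v).
  - move: q1 q2 => [q1 q1P] [q2 q2P] /asboolP/= q21 /asboolP/= q12.
    by apply/eq_exist/funext => v; apply/eqP; rewrite eq_le q12 q21.
  - have [C0|/set0P[q0 Cq0]] := eqVneq C set0.
      by exists (mkT p (conj p_sub (fun v => lexx _))) => q; rewrite C0.
    pose S v := [set sval q v | q in C].
    have le_infS v c : (forall q : T, C q -> c <= sval q v) -> c <= inf (S v).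
      move=> cq; apply: lb_le_inf; first by exists (sval q0 v), q0.
      by move=> _ [q Cq <-]; exact: cq.
    have infS_le v (q : T) : C q -> inf (S v) <= sval q v.
      move=> Cq; apply: ge_inf; last by exists q.
      (* The infimum is finite: [- p (- v) <= - q' (- v) <= q' v] for every [q'] in the chain. *)
      exists (- p (- v)) => _ [[q' [q'_sub q'p]] _ <-]/=.
      by rewrite (le_trans _ (sublinear_oppr_le v q'_sub))// lerN2.
    suff infP : sublinear (inf \o S) /\ forall v, (inf \o S) v <= p v.
      by exists (mkT _ infP) => q Cq; apply/asboolP => v; exact: infS_le.
    split=> [|v /=]; last first.
      by apply: le_trans (infS_le v q0 Cq0) _; case: (q0) => q [].
    split=> /= [u v|a v].
      rewrite -lerBlDr; apply: (le_infS) => q1 Cq1; rewrite lerBlDr -lerBlDl.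
      apply: (le_infS) => q2 Cq2; rewrite lerBlDl.
      (* The smaller of the two chain members serves for [u] and for [v] at once. *)
      have [/asboolP q12|/asboolP q21] := C_total _ _ Cq1 Cq2.
        apply: le_trans (infS_le _ _ Cq2) _.
        by apply: le_trans ((svalP q2).1.1 _ _) _; rewrite lerD.
      apply: le_trans (infS_le _ _ Cq1) _.
      by apply: le_trans ((svalP q1).1.1 _ _) _; rewrite lerD.
    rewrite le_eqVlt => /predU1P[<-|a0].
      rewrite scale0r mul0r (le_trans (infS_le 0 _ Cq0))//.
      have := sublinearZ 0 (svalP q0).1 (lexx 0).
      by rewrite scale0r mul0r => ->.
    rewrite -ler_pdivrMl//; apply: (le_infS) => q Cq; rewrite ler_pdivrMl//.
    apply: le_trans (infS_le _ _ Cq) _.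
    by apply: (svalP q).1.2; exact: ltW.
case: q qmin => q [q_sub qp] qmin; exists q; split=> // q' q'_sub q'q.
have q'p v : q' v <= p v by exact: le_trans (q'q v) (qp v).
by apply: (congr1 sval (qmin (mkT q' (conj q'_sub q'p)) _)); exact/asboolP.
Qed.

(** A minimal [q] is not changed by a descent in any direction [u], so [q (- u) <= - q u] and [q] is
    linear. Descending first in the direction [v] forces [q (- v) <= - p v], hence [q v = p v]. *)
Lemma hahn_banach {p} v : sublinear p ->
  exists q, [/\ linear q, forall u, q u <= p u & q v = p v].
Proof.
move=> /(sublinear_descent v)[p' [p'_sub p'p p'v]].
have [q [q_sub qp' qmin]] := minimal_sublinear p'_sub.
have qN u : q (- u) <= - q u.
  have [q' [q'_sub q'q q'u]] := sublinear_descent u q_sub.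
  by move: q'u; rewrite (qmin q').
exists q; split; first exact: sublinear_odd_linear.
  by move=> u; exact: le_trans (qp' u) (p'p u).
apply/eqP; rewrite eq_le (le_trans (qp' v) (p'p v))/=.
by have := qp' (- v); have := sublinear_oppr_le v q_sub; lra.
Qed.

End HahnBanach.

(** * Bounded functionals and norming functionals *)

Section Functionals.
Context {R : realType} {V : normedModType R}.
Implicit Types (v : V) (f : dual V).

Lemma dual_le_norm f v : `|f v| <= `|f| * `|v|.
Proof.
have [->|v0] := eqVneq v 0; first by rewrite linear0 !normr0 mulr0.
have nv0 : 0 < `|v| by rewrite normr_gt0.
rewrite -ler_pdivrMr// mulrC -[`|v|^-1]gtr0_norm ?invr_gt0// -normrM.
have <- : f (`|v|^-1 *: v) = `|v|^-1 * f v by rewrite linearZ.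
by rewrite dual_norm_ub// normrZ normfV normr_id mulVf ?gt_eqF.
Qed.

Lemma dual_of_bounded {q : V -> R} {c : R} : 0 <= c -> linear q ->
  (forall v, `|q v| <= c * `|v|) -> exists f, f =1 q /\ `|f| <= c.
Proof.
move=> c0 q_lin qc.
pose q' : {linear V -> R} := HB.pack q (GRing.isLinear.Build R V R _ q q_lin).
have q_cont : continuous q.
  apply: (@bounded_linear_continuous _ _ _ q'); apply/linear_boundedP.
  exists c; split; first exact: num_real.
  by move=> r cr v; apply: le_trans (qc v) _; rewrite ler_wpM2r// ltW.
have qP : q \in @continuous_linear R V by apply/continuous_linearP.
exists (Dual qP); split=> //; apply: dual_norm_le => v v1 /=.
by apply: le_trans (qc v) _; rewrite ler_piMr.
Qed.

(** Hahn-Banach with the norm as dominating functional; the one-sided bound at [- u] makes it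
    two-sided. The norm is only bounded by 1, which also covers the zero space. *)
Lemma norming_functional v :
  exists f : dual V, `|f| <= 1 /\ f v = `|v|.
Proof.
have norm_sub : sublinear (fun u : V => `|u|).
  by split=> [u w|a u a0]; rewrite ?ler_normD// normrZ ger0_norm.
have [q [q_lin q1 qv]] := hahn_banach v norm_sub.
pose q' : {linear V -> R} := HB.pack q (GRing.isLinear.Build R V R _ q q_lin).
have [|f [fq f1]] := dual_of_bounded ler01 q_lin.
  move=> u; rewrite mul1r ler_norml q1 andbT lerNl.
  by have := q1 (- u); rewrite normrN -[q]/(q' : V -> R) linearN.
by exists f; split; rewrite // fq.
Qed.

End Functionals.

(** * Slices, and the tree of signs given by the strong diameter 2 property *)

Section SignTree.
Context {R : realType} {X : normedModType R}.
Implicit Types (f g h y : dual X) (e : R).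

Lemma sliceP f e x : slice f e x <-> `|x| <= 1 /\ 1 - e < f x.
Proof. by []. Qed.

(** Take [h] to be [g + y] normalised. The point [x] gives [2 - e / 2 < |g + y| <= 2], so on the
    slice of [h] the sum [g + y] exceeds [2 - e]; as both summands are at most 1 there, each exceeds
    [1 - e]. *)
Lemma slice_inter g y e x : `|g| <= 1 -> `|y| <= 1 -> 0 < e <= 1 ->
  `|x| <= 1 -> 1 - e / 4 < g x -> 1 - e / 4 < y x ->
  exists h, `|h| = 1 /\ forall z, slice h (e / 4) z -> 1 - e < g z /\ 1 - e < y z.
Proof.
move=> g1 y1 /andP[e0 e1] x1 gx yx.
have dual_le1 f z : `|f| <= 1 -> `|z| <= 1 -> f z <= 1.
  move=> f1 z1; apply: le_trans (ler_norm _) _.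
  by apply: le_trans (dual_le_norm f z) _; rewrite mulr_ile1.
have N_gt : 2 - e / 2 < `|g + y|.
  apply: (@lt_le_trans _ _ ((g + y) x)); first by rewrite dualDE; lra.
  apply: le_trans (ler_norm _) _; apply: le_trans (dual_le_norm _ _) _.
  by rewrite ler_piMr.
have N_le : `|g + y| <= 2 by apply: le_trans (ler_normD _ _) _; lra.
have N0 : 0 < `|g + y| by lra.
exists (`|g + y|^-1 *: (g + y)); split.
  by rewrite normrZ normfV normr_id mulVf ?gt_eqF.
move=> z /sliceP[z1].
rewrite dualZE [X in _ < X]mulrC ltr_pdivlMr// dualDE => gyz.
have gz1 := dual_le1 _ _ g1 z1; have yz1 := dual_le1 _ _ y1 z1.
have : e / 4 * `|g + y| <= e / 4 * 2 by rewrite ler_pM2l//; lra.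
by move: gyz; rewrite mulrBl mul1r; lra.
Qed.

Hypothesis X_SD2P : SD2P X.

Lemma SD2P_sign_functional n (g : 'I_n -> dual X) e : (0 < n)%N -> 0 < e ->
  (forall i, `|g i| = 1) ->
  exists y, `|y| <= 1 /\ forall i (b : bool),
    exists x, slice (g i) e x /\ 1 - e < (-1) ^+ b * y x.
Proof.
move=> n0 e0 g1; have nR0 : 0 < n%:R :> R by rewrite ltr0n.
have diam2 : diameter (convex_combination (fun=> n%:R^-1)
    (fun i : 'I_n => slice (g i) e)) = 2%:E.
  apply: X_SD2P => [i||i]; first by rewrite invr_ge0 ltW.
    by rewrite sumr_const card_ord -[LHS]mulr_natl divff ?gt_eqF.
  by exists (g i), e.
(* The defect of the average is multiplied by [n] when the terms are summed, so [e / n] leaves a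
   total defect below [e]. *)
have : ((2 - e / n%:R)%:E < 2%:E :> \bar R)%E.
  by rewrite lte_fin ltrBlDr ltrDl divr_gt0.
rewrite -diam2 /diameter => /ereal_sup_gt[_ [_ [u uS <-] [_ [v vS <-] <-]]].
rewrite lte_fin => uv; have [y [y1 yuv]] := norming_functional
  (\sum_i n%:R^-1 *: u i - \sum_i n%:R^-1 *: v i).
have y_le z : `|z| <= 1 -> -1 <= y z <= 1.
  move=> z1; rewrite -ler_norml; apply: le_trans (dual_le_norm y z) _.
  by rewrite mulr_ile1.
have u1 i : `|u i| <= 1 by have [] := uS i.
have v1 i : `|v i| <= 1 by have [] := vS i.
exists y; split=> // i.
have sum_lt : \sum_j (2 - (y (u j) - y (v j))) < e.
  have : n%:R * y (\sum_i n%:R^-1 *: u i - \sum_i n%:R^-1 *: v i) =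
      \sum_j (y (u j) - y (v j)).
    rewrite -sumrB linear_sum mulr_sumr; apply: eq_bigr => j _.
    by rewrite -scalerBr linearZ/= linearB/= mulrA divff ?gt_eqF// mul1r.
  rewrite yuv => sumE; rewrite sumrB sumr_const card_ord -sumE.
  move: uv; rewrite -(ltr_pM2l nR0) mulrBr mulrCA divff ?gt_eqF// mulr1.
  by rewrite mulr_natl; lra.
(* All the defects are nonnegative, so each of them is below their sum. Then [u i] witnesses the
   sign +1 and [v i] the sign -1. *)
have {sum_lt} : 2 - (y (u i) - y (v i)) < e.
  apply: le_lt_trans sum_lt; rewrite (bigD1 i)//= lerDl sumr_ge0// => j _.
  by have := y_le _ (u1 j); have := y_le _ (v1 j); lra.
have := y_le _ (u1 i); have := y_le _ (v1 i) => yv yu yuvi [].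
  by exists (v i); split=> //; rewrite expr1; lra.
by exists (u i); split=> //; rewrite expr0; lra.
Qed.

Variable d : nat -> R.
Hypothesis d0 : forall n, 0 < d n.

(** The invariant of the recursive choice of functionals: every string of signs has its slice, and
    all these slices share one width [e]. *)
Definition sign_slices (ys : seq (dual X)) := exists2 e, 0 < e &
  forall s : seq bool, size s = size ys -> exists2 g, `|g| = 1 &
    forall x, slice g e x -> forall n, (n < size ys)%N ->
      1 - d n < (-1) ^+ nth false s n * nth 0 ys n x.

Lemma sign_slices_rcons ys : sign_slices ys ->
  exists y, `|y| <= 1 /\ sign_slices (rcons ys y).
Proof.
move=> [e e0 ysP]; pose I := (size ys).-tuple bool.
have /choice[g gP] (s : I) : exists g, `|g| = 1 /\
    forall x, slice g e x -> forall n, (n < size ys)%N ->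
      1 - d n < (-1) ^+ nth false s n * nth 0 ys n x.
  by have [|g g1 gP] := ysP s; [exact: size_tuple|exists g].
(* The bound [e] keeps the new slices inside the old ones, 1 is required by [slice_inter], and
   [d (size ys)] is the tolerance of the new functional. *)
pose e' := Num.min (Num.min e 1) (d (size ys)).
have e'0 : 0 < e' by rewrite !lt_min e0 ltr01 d0.
have e'1 : e' <= 1 by rewrite !ge_min lexx orbT.
have e'e : e' <= e by rewrite !ge_min lexx.
have e'd : e' <= d (size ys) by rewrite !ge_min lexx !orbT.
have [| |i|y [y1 yP]] := @SD2P_sign_functional #|{: I}| (g \o enum_val) (e' / 4).
- by apply/card_gt0P; exists [tuple of nseq (size ys) false].
- by rewrite divr_gt0.
- by have [] := gP (enum_val i).
exists y; split=> //; exists (e' / 4); first by rewrite divr_gt0.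
case/lastP => [|s b]; rewrite !size_rcons// => -[/eqP sE].
pose t : I := Tuple sE; have [x [[x1 gx] yx]] := yP (enum_rank t) b.
rewrite /= enum_rankK in gx.
have [| | | | | |h [h1 hP]] := @slice_inter (g t) ((-1) ^+ b *: y) e' x.
- by have [-> _] := gP t.
- by rewrite normrZ normrX normrN1 expr1n mul1r.
- by rewrite e'0.
- exact: x1.
- exact: gx.
- by rewrite dualZE.
exists h => // z hz n; have [gz yz] := hP z hz.
rewrite ltnS leq_eqVlt => /predU1P[->|nys].
  rewrite !nth_rcons (eqP sE) ltnn eqxx.
  by move: yz; rewrite dualZE; lra.
have [_ /(_ z)] := gP t; rewrite !nth_rcons (eqP sE) nys; apply=> //.
by split; [case: hz|rewrite /=; lra].
Qed.

Lemma SD2P_sign_tree : (exists x : X, x != 0) -> exists y : nat -> dual X,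
  (forall n, `|y n| <= 1) /\
  forall s : seq bool, exists x, `|x| <= 1 /\
    forall n, (n < size s)%N -> 1 - d n < (-1) ^+ nth false s n * y n x.
Proof.
move=> [x0 x0_neq0].
(* Without functionals the sign condition is vacuous; only a functional of norm 1 is needed, and
   [x0] provides it. *)
have slices0 : sign_slices [::].
  have [f [f1 fx]] := norming_functional x0.
  have f1' : `|f| = 1.
    apply/eqP; rewrite eq_le f1/= -(ler_pM2r (x := `|x0|)) ?normr_gt0// mul1r.
    by rewrite -{1}fx (le_trans (ler_norm _))// dual_le_norm.
  by exists 1 => // s _; exists f.
have /choice[c cP] ys : exists y, sign_slices ys ->
    `|y| <= 1 /\ sign_slices (rcons ys y).
  have [/sign_slices_rcons[y yP]|] := pselect (sign_slices ys); first by exists y.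
  by exists 0.
pose build n := iter n (fun ys => rcons ys (c ys)) [::].
have build_slices n : sign_slices (build n).
  by elim: n => //= n /cP[].
have size_build n : size (build n) = n.
  by elim: n => //= n nE; rewrite size_rcons nE.
exists (c \o build); split=> [n|s]; first by have [] := cP _ (build_slices n).
have [e e0 /(_ s)] := build_slices (size s); rewrite size_build => -[//|g g1 gP].
(* The case of a single slice shows that [slice g e] is nonempty. *)
have [|//|//|y [_ /(_ ord0 false)[x [gx _]]]] :=
  @SD2P_sign_functional 1 (fun=> g) e; first by [].
exists x; split=> [|n ns]; first by case: gx.
(* Later stages only append, so entry [n] is the functional chosen at stage [n]. *)
have -> : (c \o build) n = nth 0 (build (size s)) n; last exact: gP.
elim: (size s) ns => // N IH; rewrite ltnS leq_eqVlt /= nth_rcons size_build.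
by move=> /predU1P[->|nN]; rewrite ?ltnn ?eqxx// nN; exact: IH.
Qed.

End SignTree.

(** * Approximation in measure by the members of an algebra of sets *)

Section Approximation.
Context {d} {T : measurableType d} {R : realType}.
Implicit Types (A B : set T) (S : set (set T)).

Definition approximable (mu : {measure set T -> \bar R}) S A :=
  measurable A /\
  forall e : R, 0 < e -> exists2 B, S B & (mu (A `+` B) < e%:E)%E.

Variables (mu : {measure set T -> \bar R}) (S : set (set T)).
Hypothesis mu_fin : (mu setT < +oo)%E.
Hypothesis S_meas : forall A, S A -> measurable A.
Hypothesis S_setC : forall A, S A -> S (~` A).
Hypothesis S_setU : forall A B, S A -> S B -> S (A `|` B).

Let measurableY A B : measurable A -> measurable B -> measurable (A `+` B).
Proof. by move=> mA mB; apply: measurableU; exact: measurableD. Qed.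

Lemma approximable_self A : S A -> approximable mu S A.
Proof.
move=> SA; split=> [|e e0]; first exact: S_meas.
by exists A => //; rewrite setYK measure0 lte_fin.
Qed.

Lemma approximableC A : approximable mu S A -> approximable mu S (~` A).
Proof.
move=> [mA A_approx]; split=> [|e /A_approx[B SB AB]]; first exact: measurableC.
exists (~` B); first exact: S_setC.
by rewrite /setY !setDE !setCK setUC [~` B `&` _]setIC [~` A `&` _]setIC.
Qed.

(** The triangle inequality for the measure of the symmetric difference. *)
Lemma approximable_near A : measurable A ->
  (forall e : R, 0 < e -> exists2 A', approximable mu S A' &
     (mu (A `+` A') < e%:E)%E) -> approximable mu S A.
Proof.
move=> mA A_near; split=> // e e0; have e20 : 0 < e / 2 by rewrite divr_gt0.
have [A' [mA' A'_approx] AA'] := A_near _ e20.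
have [B SB A'B] := A'_approx _ e20; exists B => //.
rewrite [e]splitr EFinD; apply: le_lt_trans (lteD AA' A'B).
apply: le_trans (measureU2 _ _ _); [|exact: measurableY|].
  apply: le_measure; rewrite ?inE; [| |].
  - by apply: measurableY => //; exact: S_meas.
  - by apply: measurableU; apply: measurableY => //; exact: S_meas.
  move=> x [[Ax Bx]|[Bx Ax]]; have [A'x|A'x] := pselect (A' x).
  - by right; left.
  - by left; left.
  - by left; right.
  - by right; right.
by apply: measurableY => //; exact: S_meas.
Qed.

Lemma approximableU A B :
  approximable mu S A -> approximable mu S B -> approximable mu S (A `|` B).
Proof.
move=> [mA A_approx] [mB B_approx]; split=> [|e e0]; first exact: measurableU.
have e20 : 0 < e / 2 by rewrite divr_gt0.
have [A' SA' AA'] := A_approx _ e20; have [B' SB' BB'] := B_approx _ e20.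
have mA' := S_meas _ SA'; have mB' := S_meas _ SB'.
exists (A' `|` B'); first exact: S_setU.
rewrite [e]splitr EFinD; apply: le_lt_trans (lteD AA' BB').
apply: le_trans (measureU2 _ (measurableY _ _ mA mA') (measurableY _ _ mB mB')).
apply: le_measure; rewrite ?inE.
- by apply: measurableY; exact: measurableU.
- by apply: measurableU; exact: measurableY.
move=> x [[[Ax|Bx] /not_orP[A'x B'x]]|[[A'x|B'x] /not_orP[Ax Bx]]].
- by left; left.
- by right; left.
- by left; right.
- by right; right.
Qed.

(** The finite unions [U n] are approximable, and the remainders [D n] decrease to the empty set.
    Since [mu] is finite, their measures tend to 0. *)
Lemma approximable_bigcup (F : (set T)^nat) :
  (forall n, approximable mu S (F n)) -> approximable mu S (\bigcup_n F n).
Proof.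
move=> F_approx; have mF n : measurable (F n) by have [] := F_approx n.
have mbigcupF : measurable (\bigcup_n F n) by exact: bigcupT_measurable.
pose U n := \big[setU/set0]_(i < n.+1) F i.
have U_approx n : approximable mu S (U n).
  rewrite /U; elim: n => [|n IH]; first by rewrite big_ord_recl big_ord0 setU0.
  by rewrite big_ord_recr; exact: approximableU.
have mU n : measurable (U n) by have [] := U_approx n.
pose D n := \bigcup_n F n `\` U n.
have mD n : measurable (D n) by exact: measurableD.
have bigcapD : \bigcap_n D n = set0.
  rewrite /D -subset0 => x Dx; have [[k _ Fkx] _] := Dx 0 I.
  by have [_] := Dx k I; apply; rewrite /U big_ord_recr; right.
have : (mu \o D) n @[n --> \oo] --> 0%E.
  rewrite -(measure0 mu) -bigcapD; apply: nonincreasing_cvg_mu => //.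
  - by apply: le_lt_trans mu_fin; apply: le_measure; rewrite ?inE.
  - by rewrite bigcapD.
  - move=> n m nm; apply/subsetPset; apply: setDS.
    by apply: subset_bigsetU; rewrite ltnS.
move=> /fine_cvgP[D_fin D_cvg]; apply: approximable_near => // e e0.
have [n Dn_fin De] : exists2 n, mu (D n) \is a fin_num & fine (mu (D n)) < e.
  near \oo => n; exists n; first by near: n.
  by apply: le_lt_trans (ler_norm _) _; near: n; apply: cvgr0_norm_lt.
exists (U n) => //; rewrite (_ : _ `+` _ = D n).
  by rewrite -(fineK Dn_fin) lte_fin.
rewrite /setY [U n `\` _](_ : _ = set0) ?setU0// -subset0 => x [Ux].
by apply; exact: bigsetU_bigcup Ux.
Unshelve. all: by end_near. Qed.

Lemma approximable_sigma : S !=set0 -> sigma_algebra setT (approximable mu S).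
Proof.
move=> [A SA]; split.
- have: approximable mu S (A `|` ~` A) by apply/approximable_self/S_setU/S_setC.
  by move=> /approximableC; rewrite setUv setCT.
- by move=> B; rewrite setTD; exact: approximableC.
- exact: approximable_bigcup.
Qed.

End Approximation.

(** * A countable dense family of sets in a countably generated sigma-algebra *)

Section CountablyGenerated.
Context {d} {T : measurableType d}.
Implicit Types (a : (set T)^nat).

(* The algebra of sets generated by the a n, coded by trees: leaves are
   generators, nodes are unions, complemented when labelled by 0. *)
Fixpoint coded_set a (t : GenTree.tree nat) : set T :=
  match t with
  | GenTree.Leaf n => a n
  | GenTree.Node k ts =>
      let U := foldr (fun t A => coded_set a t `|` A) set0 ts in
      if k is 0%N then ~` U else U
  end.

Lemma coded_set_measurable a : (forall n, measurable (a n)) ->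
  forall t, measurable (coded_set a t).
Proof.
move=> ma; fix IH 1 => -[n|k ts] /=; first exact: ma.
have mU : measurable (foldr (fun t A => coded_set a t `|` A) set0 ts).
  by elim: ts => //= t ts IHts; apply: measurableU; [exact: IH|exact: IHts].
by case: k => [|_]; [exact: measurableC|exact: mU].
Qed.

(** There are countably many trees, and the sets approximable by coded sets form a sigma-algebra
    containing the generators. The family [D] comes from the codes alone, so it serves every finite
    measure. *)
Lemma countable_dense_sets {R : realType} a : <<s range a >> = measurable ->
  exists D : (set T)^nat, (forall n, measurable (D n)) /\
    forall mu : {measure set T -> \bar R}, (mu setT < +oo)%E ->
    forall A, measurable A -> forall e : R, 0 < e ->
    exists n, (mu (A `+` D n) < e%:E)%E.
Proof.
move=> a_gen; have ma n : measurable (a n).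
  by rewrite -a_gen; apply: sub_sigma_algebra; exists n.
exists (fun n => if unpickle n is Some t then coded_set a t else set0).
split=> [n|mu mu_fin A].
  by case: unpickle => // t; exact: coded_set_measurable.
have sigma_approx : sigma_algebra setT (approximable mu (range (coded_set a))).
  apply: approximable_sigma => //.
  - by move=> _ [t _ <-]; exact: coded_set_measurable.
  - move=> _ [t _ <-]; exists (GenTree.Node 0 [:: t]) => //=.
    by rewrite setU0.
  - move=> _ _ [t _ <-] [t' _ <-]; exists (GenTree.Node 1 [:: t; t']) => //=.
    by rewrite setU0.
  - by exists (coded_set a (GenTree.Leaf 0)), (GenTree.Leaf 0).
rewrite -a_gen => /(smallest_sub sigma_approx)[_ [n _ <-]|_ + e e0].
  apply: approximable_self; last by exists (GenTree.Leaf n).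
  by move=> _ [t _ <-]; exact: coded_set_measurable.
move=> /(_ e e0)[_ [t _ <-] At].
by exists (pickle t); rewrite pickleK.
Qed.

End CountablyGenerated.

Lemma rational_rays_generate (R : realType) (q : nat -> rat) :
  (forall r, exists n, q n = r) ->
  <<s range (fun n => `]ratr (q n), +oo[%classic : set (measurableTypeR R)) >> =
  (measurable : set (set (measurableTypeR R))).
Proof.
move=> q_surj; apply/seteqP; split.
  apply: smallest_sub; first exact: sigma_algebra_measurable.
  by move=> _ [n _ <-].
rewrite [X in X `<=` _](RGenOInfty.measurableE R).
apply: smallest_sub; first exact: smallest_sigma_algebra.
move=> _ [x ->].
(* An open ray is the union of the rational rays starting to the right of its endpoint; the other
   indices contribute the empty set. *)
pose F n : set R := if x < ratr (q n) then `]ratr (q n), +oo[%classic else set0.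
have -> : `]x, +oo[%classic = \bigcup_n F n.
  apply/seteqP; split=> [y|y [n _]].
    rewrite /= in_itv/= andbT => /rat_in_itvoo[r].
    rewrite in_itv/= => /andP[xr ry]; have [n qn] := q_surj r.
    by exists n => //; rewrite /F qn xr/= in_itv/= ry.
  rewrite /F; case: ifPn => // xq.
  by rewrite /= !in_itv/= !andbT; exact: lt_trans.
apply: sigma_algebra_bigcup => n; rewrite /F.
case: ifP => _; last exact: sigma_algebra0.
by apply: sub_sigma_algebra; exists n.
Qed.

(** * A limit for bounded real sequences along an ultrafilter *)

Lemma generalized_limit (R : realType) : exists L : (nat -> R) -> R,
  [/\ forall a (u v : nat -> R) M, (forall n, `|u n| <= M) -> (forall n, `|v n| <= M) ->
        L (fun n => a * u n + v n) = a * L u + L v,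
      forall u M, (forall n, `|u n| <= M) -> `|L u| <= M &
      forall u M c, (forall n, `|u n| <= M) -> (\forall n \near \oo, c <= u n) ->
        c <= L u].
Proof.
have [U [U_ultra U_oo]] := @ultraFilterLemma nat \oo _.
have cvgU (u : nat -> R) M : (forall n, `|u n| <= M) -> cvg (u n @[n --> U]).
  move=> uM; have [|l [_ ul]] := @segment_compact R (- M) M (u n @[n --> U]) _.
    by apply: nearW => n; rewrite /= in_itv/= -ler_norml.
  (* A cluster point of an ultrafilter is a limit: otherwise the complement of a neighbourhood [A]
     of [l] would belong to the image filter and still meet [A]. *)
  apply: (cvgP l) => A Al.
  have [//|U_A] := in_ultra_setVsetC (u @^-1` A) U_ultra.
  by have [x []] := ul (~` A) A U_A Al.
exists (fun u => lim (u n @[n --> U])); split.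
- move=> a u v M uM vM; apply/cvg_lim => //; apply: cvgD; last exact: cvgU vM.
  by apply: cvgM; [exact: cvg_cst|exact: cvgU uM].
- move=> u M uM; rewrite ler_norml; apply/andP; split.
    apply: limr_ge; first exact: cvgU uM.
    by apply: nearW => n; have := uM n; rewrite ler_norml => /andP[].
  apply: limr_le; first exact: cvgU uM.
  by apply: nearW => n; have := uM n; rewrite ler_norml => /andP[].
- move=> u M c uM cu; apply: limr_ge; first exact: cvgU uM.
  exact: U_oo.
Qed.

(** * The pairing of integrable classes with bounded measurable functions *)

Section Pairing.
Context {d} {T : measurableType d} {R : realType}.
Variable mu : {measure set T -> \bar R}.
Implicit Types (f g : L1 mu) (h k : T -> R).

Lemma L1_integrable f : mu.-integrable setT (EFin \o L1_fun f).
Proof. exact/Lfun1_integrable/L1_fun_Lfun. Qed.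

Lemma measurable_L1_neg f : measurable [set t | L1_fun f t < 0].
Proof.
have mf : measurable_fun setT (L1_fun f).
  by apply/measurable_EFinP; exact: measurable_int (L1_integrable f).
have m0 : measurable_fun setT (cst 0 : T -> R) by [].
rewrite -[X in measurable X]setTI.
exact: (measurable_fun_ltr mf m0 _ (Y := [set true])).
Qed.

Lemma L1_fun_linear (a : R) f g :
  L1_fun (a *: f + g) = (fun t => a * L1_fun f t + L1_fun g t) %[ae mu].
Proof.
have -> : a *: f + g = L1_pi (a *: L1_repr f + L1_repr g).
  by rewrite -L1_piD -L1_piZ !L1_reprK.
exact: L1_piK.
Qed.

Lemma L1_norm_Rintegral f : `|f| = (\int[mu]_t `|L1_fun f t|)%R.
Proof. by rewrite /Rintegral -L1_normEint. Qed.

Let integrableZ (a : R) k : mu.-integrable setT (EFin \o k) ->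
  mu.-integrable setT (EFin \o (fun t => a * k t)).
Proof. exact: integrableZl. Qed.

Definition pairing f h : R := (\int[mu]_t (L1_fun f t * h t))%R.

Variable M : R.

Lemma pairing_integrable f h : measurable_fun setT h ->
  (forall t, `|h t| <= M) ->
  mu.-integrable setT (EFin \o (fun t => L1_fun f t * h t)).
Proof.
move=> mh hM; apply: (@integrableMl _ _ _ _ _ _ (EFin \o L1_fun f) h) => //.
  exact: L1_integrable.
exists M; split; first exact: num_real.
by move=> r Mr t _; rewrite /= (le_trans (hM t))// ltW.
Qed.

Lemma pairing_linear_l (a : R) f g h : measurable_fun setT h ->
  (forall t, `|h t| <= M) ->
  pairing (a *: f + g) h = a * pairing f h + pairing g h.
Proof.
move=> mh hM; have int f0 := pairing_integrable f0 h mh hM.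
rewrite /pairing -RintegralZl//.
rewrite -RintegralD//; last exact: integrableZ (int f).
congr fine; apply: ae_eq_integral => //.
- exact: measurable_int (int _).
- exact: measurable_int (integrableD measurableT (integrableZ a _ (int f)) (int g)).
- apply: filterS (L1_fun_linear a f g) => t fgt _ /=; rewrite fgt//.
  by rewrite mulrDl mulrA.
Qed.

Lemma pairing_linear_r (a : R) f h k : measurable_fun setT h ->
  measurable_fun setT k -> (forall t, `|h t| <= M) -> (forall t, `|k t| <= M) ->
  pairing f (fun t => a * h t + k t) = a * pairing f h + pairing f k.
Proof.
move=> mh mk hM kM.
have inth := pairing_integrable f h mh hM.
have intk := pairing_integrable f k mk kM.
rewrite /pairing -RintegralZl// -RintegralD//; last exact: integrableZ.
by apply: eq_Rintegral => t _; rewrite mulrDr mulrCA.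
Qed.

Lemma pairing_le f h : measurable_fun setT h -> (forall t, `|h t| <= M) ->
  `|pairing f h| <= M * `|f|.
Proof.
move=> mh hM; have int := pairing_integrable f h mh hM.
have intf := integrable_norm (L1_integrable f).
apply: le_trans (le_normr_Rintegral _ _) _ => //.
rewrite L1_norm_Rintegral -RintegralZl//; apply: le_Rintegral => //.
- exact: integrable_norm int.
- exact: integrableZ.
- by move=> t _; rewrite normrM mulrC ler_wpM2r.
Qed.

End Pairing.

Section PairingSign.
Context {d} {T : measurableType d} {R : realType}.
Variable mu : {measure set T -> \bar R}.

(** Where [D] agrees with the set on which [f] is negative, [(-1) ^+ (t \in D)] is a sign of [f] and
    the integrand is at least [(1 - delta) * |f|]. Elsewhere it is at least [- |f|], which costs at
    most [2 * |f|]. *)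
Lemma pairing_ge (f : L1 mu) (h : T -> R) (D : set T) (delta : R) :
  measurable D -> measurable_fun setT h -> (forall t, `|h t| <= 1) ->
  0 <= delta -> (forall t, 1 - delta <= (-1) ^+ (t \in D) * h t) ->
  (1 - delta) * `|f| -
    2 * (\int[mu]_(t in [set t | L1_fun f t < 0%R] `+` D) `|L1_fun f t|)%R
    <= pairing mu f h.
Proof.
move=> mD mh h1 delta0 hD; set A := [set t | _].
have intf := integrable_norm (L1_integrable mu f).
have mA : measurable A by exact: measurable_L1_neg.
have mAD : measurable (A `+` D) by apply: measurableU; exact: measurableD.
pose F := (fun t => `|L1_fun f t|) \_ (A `+` D).
have intF : mu.-integrable setT (EFin \o F).
  rewrite /F -restrict_EFin; apply/(integrable_mkcond _ mAD).
  exact: (integrableS measurableT mAD).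
have intf' : mu.-integrable setT (EFin \o (fun t => (1 - delta) * `|L1_fun f t|)).
  exact: integrableZl intf.
have intF' : mu.-integrable setT (EFin \o (fun t => 2 * F t)).
  exact: integrableZl intF.
rewrite Rintegral_mkcond L1_norm_Rintegral -RintegralZl// -RintegralZl//.
rewrite -RintegralB//; apply: le_Rintegral => //.
- exact: integrableB intf' intF'.
- exact: pairing_integrable h1.
move=> t _; rewrite patchE; have := h1 t; rewrite ler_norml => /andP[hN1 hle1].
have [AD /=|AD] := boolP (t \in A `+` D).
  by have [ft|ft] := ltP (L1_fun f t) 0; [rewrite ltr0_norm//|rewrite ger0_norm//]; nra.
have := hD t; rewrite mulr0 subr0.
have [ft|ft] := ltP (L1_fun f t) 0.
  have -> : t \in D.
    rewrite inE; apply: contrapT => Dt; move: AD; rewrite notin_setE; apply.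
    by left.
  by rewrite ltr0_norm// expr1; nra.
have -> : t \in D = false.
  apply/negbTE; rewrite notin_setE => Dt; move: AD; rewrite notin_setE; apply.
  by right; split=> //; rewrite /A/= ltNge ft.
by rewrite ger0_norm// expr0; nra.
Qed.

End PairingSign.

(** * The isometric embedding into the bidual *)

Section Embedding.
Context {d} {T : measurableType d} {R : realType}.
Variable mu : {measure set T -> \bar R}.
Variable X : normedModType R.

(** Induction on the length, with a case split on the last bit; [g] is arbitrary because the split
    replaces it by [g] with that bit fixed. *)
Lemma measurable_fun_mkseq (b : nat -> T -> bool) (N : nat) (g : seq bool -> R) :
  (forall n, measurable_fun setT (b n)) ->
  measurable_fun setT (fun t => g (mkseq (b^~ t) N)).
Proof.
move=> mb; elim: N g => [|N IH] g; first by rewrite /mkseq/=; exact: measurable_cst.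
rewrite [X in measurable_fun _ X](_ : _ = fun t => if b N t
    then g (rcons (mkseq (b^~ t) N) true)
    else g (rcons (mkseq (b^~ t) N) false)).
  by apply: measurable_fun_ifT; [exact: mb|exact: (IH (g \o rcons^~ true))|
    exact: (IH (g \o rcons^~ false))].
by apply/funext => t; rewrite mkseqS; case: (b N t).
Qed.

Variables (D : (set T)^nat) (delta : nat -> R).
Hypothesis mD : forall n, measurable (D n).
Hypothesis delta0 : forall n, 0 < delta n.
Hypothesis delta_norming : forall (f : L1 mu) (e : R), 0 < e ->
  exists n, delta n < e /\
    (\int[mu]_(t in [set t | L1_fun f t < 0%R] `+` D n) `|L1_fun f t|)%R < e.

Lemma L1_embeds_bidual : SD2P X -> (exists x : X, x != 0) ->
  exists iota : {linear L1 mu -> dual (dual X)}, forall f, `|iota f| = `|f|.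
Proof.
move=> X_SD2P /(SD2P_sign_tree X_SD2P delta delta0)[y [y1 /choice[x xP]]].
have [L [L_lin L_le L_ge]] := generalized_limit R.
pose b n t := t \in D n.
have mb n : measurable_fun setT (b n).
  apply: (measurable_fun_bool true); rewrite setTI.
  rewrite (_ : _ @^-1` _ = D n)//.
  by apply/seteqP; split=> t; [exact: set_mem|exact: mem_set].
pose h N (g : dual X) t := g (x (mkseq (b^~ t) N)).
have mh N g : measurable_fun setT (h N g) by exact: (measurable_fun_mkseq _ _ (g \o x)).
have h_le N g t : `|h N g t| <= `|g|.
  apply: le_trans (dual_le_norm _ _) _; rewrite ler_piMr//.
  by have [] := xP (mkseq (b^~ t) N).
pose B f g N := pairing mu f (h N g).
have B_le f g N : `|B f g N| <= `|g| * `|f| by exact: pairing_le.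
have hD N (a : R) g1 g2 : h N (a *: g1 + g2) = fun t => a * h N g1 t + h N g2 t.
  by [].
have B_linr f (a : R) g1 g2 : L (B f (a *: g1 + g2)) = a * L (B f g1) + L (B f g2).
  have g1_le : `|g1| <= `|g1| + `|g2| by rewrite lerDl.
  have g2_le : `|g2| <= `|g1| + `|g2| by rewrite lerDr.
  rewrite -(L_lin _ _ _ ((`|g1| + `|g2|) * `|f|)).
  - congr L; apply/funext => N; rewrite /B hD.
    apply: (@pairing_linear_r _ _ _ _ (`|g1| + `|g2|)) => // t.
      exact: le_trans (h_le _ _ _) _.
    exact: le_trans (h_le _ _ _) _.
  - by move=> N; apply: le_trans (B_le _ _ _) _; rewrite ler_wpM2r.
  - by move=> N; apply: le_trans (B_le _ _ _) _; rewrite ler_wpM2r.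
have B_linl f1 f2 (a : R) g : L (B (a *: f1 + f2) g) = a * L (B f1 g) + L (B f2 g).
  rewrite -(L_lin _ _ _ (`|g| * (`|f1| + `|f2|))).
  - congr L; apply/funext => N.
    exact: (@pairing_linear_l _ _ _ _ `|g|).
  - by move=> N; apply: le_trans (B_le _ _ _) _; rewrite ler_wpM2l// lerDl.
  - by move=> N; apply: le_trans (B_le _ _ _) _; rewrite ler_wpM2l// lerDr.
have /choice[iota iotaP] (f : L1 mu) :
    exists F : dual (dual X), (forall g, F g = L (B f g)) /\ `|F| <= `|f|.
  apply: (@dual_of_bounded _ (dual X) (fun g => L (B f g)) `|f|) => // [a g1 g2|g].
    exact: B_linr.
  by rewrite mulrC; apply: L_le => N; exact: B_le.
have iota_lin : linear iota.
  move=> a f1 f2; apply: dualP => g.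
  by rewrite dualDE dualZE !(iotaP _).1.
pose iota' : {linear L1 mu -> dual (dual X)} :=
  HB.pack iota (GRing.isLinear.Build R (L1 mu) (dual (dual X)) _ iota iota_lin).
exists iota' => f; change (`|iota f| = `|f|).
apply/eqP; rewrite eq_le (iotaP f).2/=; apply/ler_addgt0Pr => e e0.
(* The total loss is [delta n * |f|] plus twice an integral, so the tolerance [e / (|f| + 2)] for
   both keeps it below [e]. *)
have c0 : 0 < `|f| + 2 by rewrite ltr_wpDl.
have [n [dn fn]] := delta_norming f _ (divr_gt0 e0 c0).
have iota_yn : iota f (y n) <= `|iota f|.
  apply: le_trans (ler_norm _) _; apply: le_trans (dual_le_norm _ _) _.
  by rewrite ler_piMr.
apply: (@le_trans _ _ (L (B f (y n)) + e)); last by rewrite lerD2r -(iotaP f).1.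
rewrite -lerBlDr; apply: L_ge (B_le f (y n)) _.
(* A string of length [N] controls [y n] only when [n < N]. *)
near=> N; have nN : (n < N)%N by near: N; exact: nbhs_infty_gt.
apply: le_trans (pairing_ge mu f (h N (y n)) (D n) (delta n) (mD n) _ _ _ _) => //.
- have eE : (`|f| + 2) * (e / (`|f| + 2)) = e.
    by rewrite mulrCA divff ?mulr1// gt_eqF.
  have : delta n * `|f| <= e / (`|f| + 2) * `|f| by rewrite ler_wpM2r// ltW.
  by move: eE fn; set r := e / _; lra.
- by move=> t; apply: le_trans (h_le _ _ _) _.
- exact: ltW.
- move=> t; have [_ /(_ n)] := xP (mkseq (b^~ t) N).
  by rewrite size_mkseq => /(_ nN); rewrite nth_mkseq// => /ltW.
Unshelve. all: by end_near. Qed.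

End Embedding.

(** * Lebesgue measure on the unit interval *)

Lemma lebesgue01_finite (R : realType) : (lebesgue01 R setT < +oo)%E.
Proof.
rewrite /lebesgue01/= /mrestr setTI lebesgue_measure_itv/= lte_fin ltr01.
by rewrite -EFinB ltry.
Qed.

Theorem theorem2p5 (R : realType) (X : completeNormedModType R)
    (X_neq0 : exists x : X, x != 0) (X_SD2P : SD2P X) :
  exists iota : {linear L1 (lebesgue01 R) -> dual (dual X)},
    forall f : L1 (lebesgue01 R), `|iota f| = `|f|.
Proof.
have q_surj (r : rat) : exists n, odflt 0 (unpickle n) = r.
  by exists (pickle r); rewrite pickleK.
have [D [mD D_dense]] := countable_dense_sets (T := measurableTypeR R) (R := R) _
  (rational_rays_generate R _ q_surj).
(* Indexing by pairs makes every D k occur with arbitrarily small tolerance. *)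
pose p n : nat * nat := odflt (0, 0)%N (unpickle n).
refine (L1_embeds_bidual (lebesgue01 R) X (fun n => D (p n).2)
  (fun n => (p n).1.+1%:R^-1) (fun n => mD _) _ _ X_SD2P X_neq0) => [//|f e e0].
(* Absolute continuity of the integral turns approximation in measure of the negative set of [f]
   into a small integral of [|f|] over the symmetric difference. *)
have [r [r0 fr]] := integral_normr_continuous (L1_integrable _ f) e0.
have mA := measurable_L1_neg _ f.
have [k Ak] := D_dense _ (lebesgue01_finite R) _ mA _ r0.
have [m me] : exists m, m.+1%:R^-1 < e.
  by have [m] := ltr_add_invr e0; rewrite add0r; exists m.
exists (pickle (m, k)); rewrite /p pickleK; split=> //.
by apply: fr => //; apply: measurableU; exact: measurableD.
Qed.
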